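(* Let $(E,+,{}',0,1)$ be a lattice effect algebra with induced order $\leq$ and join $\vee$, and define $x\rightarrow y:=y+(x\vee y)'$ for all $x,y\in E$. Then the following identities hold for all $x,y\in E$: (i) $x\rightarrow0=x'$; (ii) $1\rightarrow x=x$; (iii) $x\rightarrow(y\rightarrow x)=1$; (iv) $(x\rightarrow y)\rightarrow y=x\vee y$; (v) $((x\rightarrow y)\rightarrow y)\rightarrow y=x\rightarrow y$; (vi) $x\rightarrow((x\rightarrow y)\rightarrow y)=1$; (vii) $y\rightarrow((x\rightarrow y)\rightarrow y)=1$; (viii) $y'\rightarrow((x\rightarrow y)\rightarrow y)'=x\rightarrow y$.
   Context: An effect algebra is a structure $(E,+,{}',0,1)$ where $E$ is a set, ${}'$ is a unary operation on $E$, $0,1\in E$, and $+$ is a partial binary operation on $E$ such that for all $x,y,z\in E$: (E1) if $x+y$ is defined then so is $y+x$ and $x+y=y+x$; (E2) $(x+y)+z$ is defined if and only if $x+(y+z)$ is defined, and then they are equal; (E3) $x+y$ is defined and equals $1$ if and only if $y=x'$; (E4) if $1+x$ is defined then $x=0$. The induced order is defined by $x\leq y$ iff there exists $z\in E$ with $x+z=y$; it is a partial order with least element $0$ and greatest element $1$. The effect algebra is a lattice effect algebra if $(E,\leq)$ is a lattice; $\vee$ and $\wedge$ denote its join and meet. *)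

(* Defs.v *)
From mathcomp Require Import all_boot.

Set Implicit Arguments.
Unset Strict Implicit.
Unset Printing Implicit Defensive.

Declare Scope ea_scope.
Delimit Scope ea_scope with EA.
Local Open Scope ea_scope.

(* The partial operation is option-valued: [padd x y = Some s] means that x + y
   is defined and equal to s, [padd x y = None] that it is undefined. *)
Record effectAlgebra := EffectAlgebra {
  ea_sort :> Type;
  padd : ea_sort -> ea_sort -> option ea_sort;
  compl : ea_sort -> ea_sort;
  ea0 : ea_sort;
  ea1 : ea_sort;
  paddC : forall x y s, padd x y = Some s -> padd y x = Some s;
  (* An equality of options: both sides are undefined, or both are defined
     and equal. *)
  paddA : forall x y z,
    obind (fun s => padd s z) (padd x y) = obind (fun t => padd x t) (padd y z);
  padd_eq1 : forall x y, padd x y = Some ea1 <-> y = compl x;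
  padd1 : forall x s, padd ea1 x = Some s -> x = ea0
}.

Arguments ea0 {e}.
Arguments ea1 {e}.

Notation "0" := ea0 : ea_scope.
Notation "1" := ea1 : ea_scope.
Notation "x ^'" := (compl x) : ea_scope.

Definition ea_le (E : effectAlgebra) (x y : E) : Prop :=
  exists z : E, padd x z = Some y.

Notation "x <= y" := (ea_le x y) : ea_scope.

(* The join and meet are operations rather than existence statements; since
   [ea_le] is antisymmetric, they are determined by the effect algebra. *)
Record latticeEffectAlgebra := LatticeEffectAlgebra {
  lea_ea :> effectAlgebra;
  join : lea_ea -> lea_ea -> lea_ea;
  meet : lea_ea -> lea_ea -> lea_ea;
  join_ubl : forall x y, x <= join x y;
  join_ubr : forall x y, y <= join x y;
  join_lub : forall x y z, x <= z -> y <= z -> join x y <= z;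
  meet_lbl : forall x y, meet x y <= x;
  meet_lbr : forall x y, meet x y <= y;
  meet_glb : forall x y z, z <= x -> z <= y -> z <= meet x y
}.

Notation "x `|` y" := (join x y) (at level 52, left associativity) : ea_scope.
Notation "x `&` y" := (meet x y) (at level 48, left associativity) : ea_scope.

Definition the (T : Type) (o : option T) : isSome o -> T :=
  match o with
  | Some t => fun _ => t
  | None => fun absurd => match notF absurd with end
  end.

Lemma theP (T : Type) (o : option T) (h : isSome o) : o = Some (the h).
Proof. by case: o h. Qed.

Lemma le_padd_compl (E : effectAlgebra) (x y : E) :
  x <= y -> isSome (padd x y^').
Proof.
case=> z /paddC xz.
have y1 : padd y y^' = Some 1 by apply/padd_eq1.
have := paddA z x y^'; rewrite xz /= y1.
by case: (padd x y^').
Qed.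

Definition arrow (E : latticeEffectAlgebra) (x y : E) : E :=
  the (le_padd_compl (join_ubr x y)).

Notation "x --> y" := (arrow x y)
  (at level 55, right associativity) : ea_scope.

Lemma arrowE (E : latticeEffectAlgebra) (x y : E) :
  padd y (x `|` y)^' = Some (x --> y).
Proof. exact: theP. Qed.

(* Main.v *)
(* For y <= z the definedness of y + z' yields (y + z')' + y = z.  Since
   x --> y = y + (x \/ y)' lies above y, applying --> y once more returns x \/ y;
   the remaining identities then follow from the values of z --> y for z <= y
   and for y <= z. *)
Require Import Defs.
From mathcomp Require Import all_boot.

Local Open Scope ea_scope.

Section EffectAlgebra.

Set Implicit Arguments.
Unset Strict Implicit.

Variable E : effectAlgebra.
Implicit Types x y z s t : E.

Lemma padd_compl x : padd x x^' = Some 1.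
Proof. by apply/padd_eq1. Qed.

Lemma complK x : x^'^' = x.
Proof. by symmetry; apply/padd_eq1/paddC/padd_compl. Qed.

Lemma padd_eq1l x y : padd x y = Some 1 -> x = y^'.
Proof. by move/paddC/padd_eq1. Qed.

Lemma compl1 : 1^' = 0 :> E.
Proof. exact: padd1 (padd_compl 1). Qed.

(** Since [0] is [1^'], (x' + x) + 0 = 1 + 0 = 1; reassociating makes x + 0 the complement of x',
    which is x. *)
Lemma paddx0 x : padd x 0 = Some x.
Proof.
have := paddA x^' x 0; rewrite (paddC (padd_compl x)) /= -compl1 padd_compl.
case: (padd x _) => //= s /esym/padd_eq1 ->.
by rewrite complK.
Qed.

Lemma padd0x x : padd 0 x = Some x.
Proof. exact/paddC/paddx0. Qed.

(** Cancellation: adding s' on the left turns both sums into 1, so y and z are both the complement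
    of s' + x. *)
Lemma paddI x y z s : padd x y = Some s -> padd x z = Some s -> y = z.
Proof.
move=> xy xz; have s1 := paddC (padd_compl s).
have := paddA s^' x y; have := paddA s^' x z; rewrite xy xz /= s1.
by case: (padd s^' x) => //= t /padd_eq1 -> /padd_eq1 ->.
Qed.

(** As 1 + (x + y) = 1 + 0 is defined, so is 1 + x, and [padd1] applies. *)
Lemma padd_eq0 x y : padd x y = Some 0 -> x = 0.
Proof.
move=> xy; have := paddA 1 x y; rewrite xy /= paddx0.
by case x1: (padd 1 x) => [s|//] _; exact: padd1 x1.
Qed.

Lemma ea_le_refl x : x <= x.
Proof. by exists 0; exact: paddx0. Qed.

Lemma ea_le0x x : 0 <= x.
Proof. by exists x; exact: padd0x. Qed.

Lemma ea_lex1 x : x <= 1.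
Proof. by exists x^'; exact: padd_compl. Qed.

Lemma ea_le_anti x y : x <= y -> y <= x -> x = y.
Proof.
case=> z xz [w yw]; have := paddA x z w; rewrite xz /= yw.
case zw: (padd z w) => [t|//] /= /esym xt.
(* Here x + (z + w) = x, so cancellation gives z + w = 0, whence z = 0. *)
have t0 := paddI xt (paddx0 x); rewrite {}t0 in zw.
by move: xz; rewrite (padd_eq0 zw) paddx0 => -[].
Qed.

Lemma compl_anti x y : x <= y -> y^' <= x^'.
Proof.
case=> z /paddC zx; exists z.
have := paddA y^' z x; rewrite zx /= (paddC (padd_compl y)).
by case: (padd y^' z) => //= t /padd_eq1l ->.
Qed.

(** From (s' + y) + z' = s' + s = 1, the sum s' + y is the complement of z'. This is what undoes an
    arrow. *)
Lemma padd_compl_swap y z s : padd y z^' = Some s -> padd y s^' = Some z.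
Proof.
move=> yz; have := paddA s^' y z^'; rewrite yz /= (paddC (padd_compl s)).
case sy: (padd s^' y) => [t|//] /= /padd_eq1l tz.
by rewrite (paddC sy) tz complK.
Qed.

End EffectAlgebra.

Section Arrow.

Set Implicit Arguments.
Unset Strict Implicit.

Variable E : latticeEffectAlgebra.
Implicit Types x y : E.

Lemma join_r x y : x <= y -> x `|` y = y.
Proof.
move=> xy; apply: ea_le_anti (join_ubr x y).
exact: join_lub (ea_le_refl y).
Qed.

Lemma join_l x y : y <= x -> x `|` y = x.
Proof.
move=> yx; apply: ea_le_anti (join_ubl x y).
exact: join_lub (ea_le_refl x) yx.
Qed.

Lemma arrow_eq1 x y : x <= y -> x --> y = 1.
Proof. by move=> xy; have := arrowE x y; rewrite join_r // padd_compl => -[]. Qed.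

Lemma padd_arrow x y : y <= x -> padd y x^' = Some (x --> y).
Proof. by move=> yx; rewrite -arrowE join_l. Qed.

Lemma le_arrow x y : y <= x --> y.
Proof. by exists (x `|` y)^'; exact: arrowE. Qed.

Lemma arrow0 x : x --> 0 = x^'.
Proof. by have := padd_arrow (ea_le0x x); rewrite padd0x => -[]. Qed.

Lemma arrow1x x : 1 --> x = x.
Proof. by have := padd_arrow (ea_lex1 x); rewrite compl1 paddx0 => -[]. Qed.

Lemma arrow_arrow x y : (x --> y) --> y = x `|` y.
Proof.
have := padd_arrow (le_arrow x y).
by rewrite (padd_compl_swap (arrowE x y)) => -[].
Qed.

Lemma arrow_join x y : (x `|` y) --> y = x --> y.
Proof. by have := padd_arrow (join_ubr x y); rewrite arrowE => -[]. Qed.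

(** Contraposition: x' lies below y', so both arrows reduce to the sum of y and x', up to
    commutativity. *)
Lemma arrow_compl x y : y <= x -> y^' --> x^' = x --> y.
Proof.
move=> yx; have := padd_arrow (compl_anti yx); rewrite complK => /paddC.
by rewrite padd_arrow // => -[].
Qed.

End Arrow.

Theorem theorem2p2 (E : latticeEffectAlgebra) (x y : E) :
  [/\ x --> 0 = x^',
      1 --> x = x,
      x --> (y --> x) = 1
    & (x --> y) --> y = x `|` y]
  /\
  [/\ ((x --> y) --> y) --> y = x --> y,
      x --> ((x --> y) --> y) = 1,
      y --> ((x --> y) --> y) = 1
    & y^' --> ((x --> y) --> y)^' = x --> y].
Proof.
split; first split.
- exact: arrow0.
- exact: arrow1x.
- exact/arrow_eq1/le_arrow.
- exact: arrow_arrow.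
(* By (iv), each remaining identity becomes one about the join, which lies above both x and y. *)
rewrite (arrow_arrow x y); split.
- exact: arrow_join.
- exact/arrow_eq1/join_ubl.
- exact/arrow_eq1/join_ubr.
- by rewrite (arrow_compl (join_ubr x y)) arrow_join.
Qed.
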